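(* Let $\Lambda$ be a set of labels, and for each $\lambda\in\Lambda$ let $w_\lambda,y_\lambda,z_\lambda$ be elements of a field; let $x$ be an element of that field. Let $G=(V,E,c)$ be an edge-labeled finite multigraph with $c:E\to\Lambda$, and consider the recurrence relation $$\xi_{lab}(H)=w_{c(e)}\xi_{lab}(H_{-e})+y_{c(e)}\xi_{lab}(H_{/e})+z_{c(e)}\xi_{lab}(H_{\dagger e})\ \text{(for every edge $e$ of $H$)},\quad \xi_{lab}(H_1\oplus H_2)=\xi_{lab}(H_1)\xi_{lab}(H_2),\quad \xi_{lab}(E_1)=x,\quad \xi_{lab}(\emptyset)=1.$$ Each of the following conditions is sufficient for this recurrence relation to be confluent: (1) $z_{c(e)}=0$ for all $e\in E$; (2) $w_{c(e)}=1$ for all $e\in E$, and $y_{c(e_1)}z_{c(e_2)}=y_{c(e_2)}z_{c(e_1)}$ for all $e_1,e_2\in E$.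
   Context: Multigraphs are finite, loops and multiple edges allowed; edges carry labels from $\Lambda$ (no algebraic structure on $\Lambda$), and edges keep their labels under the following operations. For an edge $e$: $H_{-e}$ removes $e$; $H_{/e}$ identifies the endpoints of $e$ (removing $e$; may create loops and multiple edges); $H_{\dagger e}$ is the subgraph induced by $V\setminus\{u,v\}$ where $e=\{u,v\}$. $H_1\oplus H_2$ is disjoint union, $E_1$ the one-vertex edgeless graph, $\emptyset$ the graph with no vertices. The recurrence is confluent if evaluating $\xi_{lab}$ by repeatedly applying the rules in any order (any choice of edges to eliminate and of disjoint-union decompositions) always gives the same result. *)

(* Defs.v *)
From HB Require Import structures.
From mathcomp Require Import all_boot all_algebra.

Set Implicit Arguments.
Unset Strict Implicit.
Unset Printing Implicit Defensive.

Import GRing.Theory.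
Local Open Scope ring_scope.

(* An edge is incident to the set of its one (loop) or two endpoints; distinct
   elements of [edge] may have the same endpoints and the same label. *)
Record lmgraph (L : Type) := LMGraph {
  vert : finType;
  edge : finType;
  ends : edge -> {set vert};
  lab : edge -> L;
  ends_card : forall e, (0 < #|ends e| <= 2)%N
}.
Arguments ends {L l} e.
Arguments lab {L l} e.

Lemma imset_ends_card (T T' : finType) (f : T -> T') (A : {set T}) :
  (0 < #|A| <= 2)%N -> (0 < #|f @: A| <= 2)%N.
Proof.
case/andP=> A_gt0 A_le2; rewrite (leq_trans (leq_imset_card f A) A_le2) andbT.
by rewrite card_gt0 imset_eq0 -card_gt0.
Qed.

Lemma preim_val_card (T : finType) (A B : {set T}) :
    B \subset A -> (0 < #|B| <= 2)%N ->
  (0 < #|[set u : {u : T | u \in A} | val u \in B]| <= 2)%N.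
Proof.
move=> sBA; rewrite -(card_imset _ val_inj).
suff -> : val @: [set u : {u : T | u \in A} | val u \in B] = B by [].
apply/setP=> u; apply/imsetP/idP=> [[v + ->]|Bu]; first by rewrite inE.
by exists (exist _ u (subsetP sBA u Bu)); rewrite ?inE.
Qed.

Section Operations.
Variable L : Type.
Implicit Types H : lmgraph L.

Definition del_edge H (e : edge H) : lmgraph L :=
  @LMGraph L (vert H) {f : edge H | f != e}
    (fun f => ends (val f)) (fun f => lab (val f))
    (fun f => ends_card (val f)).

(* [None] is the vertex obtained by identifying the endpoints of e; [insub]
   sends these endpoints to [None] and every other vertex u to [Some u]. *)
Definition contract_edge H (e : edge H) : lmgraph L :=
  @LMGraph L (option {u : vert H | u \notin ends e}) {f : edge H | f != e}
    (fun f => insub @: ends (val f)) (fun f => lab (val f))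
    (fun f => imset_ends_card insub (ends_card (val f))).

Definition induced H (A : {set vert H}) : lmgraph L :=
  @LMGraph L {u : vert H | u \in A} {f : edge H | ends f \subset A}
    (fun f => [set u | val u \in ends (val f)]) (fun f => lab (val f))
    (fun f => preim_val_card (valP f) (ends_card (val f))).

Definition extract_edge H (e : edge H) : lmgraph L := induced (~: ends e).

Definition disjoint_union H1 H2 : lmgraph L :=
  @LMGraph L (vert H1 + vert H2)%type (edge H1 + edge H2)%type
    (fun f => match f with
              | inl f1 => inl @: ends f1
              | inr f2 => inr @: ends f2
              end)
    (fun f => match f with inl f1 => lab f1 | inr f2 => lab f2 end)
    (fun f => match f with
              | inl f1 => imset_ends_card inl (ends_card f1)
              | inr f2 => imset_ends_card inr (ends_card f2)
              end).

Definition edgeless (T : finType) : lmgraph L :=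
  @LMGraph L T void (fun f => match f with end) (fun f => match f with end)
    (fun f => match f with end).

Definition isomorphic H1 H2 : Prop :=
  exists (phi : vert H1 -> vert H2) (psi : edge H1 -> edge H2),
    [/\ bijective phi, bijective psi,
        forall e, ends (psi e) = phi @: ends e
      & forall e, lab (psi e) = lab e].

End Operations.

Section Recurrence.
Variables (L : Type) (F : fieldType) (w y z : L -> F) (x : F).

(* [xi_eval H v]: some complete sequence of applications of the rules evaluates
   H to v. Separate occurrences of one graph may be evaluated differently.
   [xi_iso] expresses that graphs are considered up to isomorphism, so a graph
   may be split along any decomposition into a disjoint union. *)
Inductive xi_eval : lmgraph L -> F -> Prop :=
| xi_edge H (e : edge H) a b c :
    xi_eval (del_edge e) a -> xi_eval (contract_edge e) b ->
    xi_eval (extract_edge e) c ->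
    xi_eval H (w (lab e) * a + y (lab e) * b + z (lab e) * c)
| xi_union H1 H2 a b :
    xi_eval H1 a -> xi_eval H2 b -> xi_eval (disjoint_union H1 H2) (a * b)
| xi_E1 : xi_eval (edgeless L unit) x
| xi_empty : xi_eval (edgeless L void) 1
| xi_iso H1 H2 a : isomorphic H1 H2 -> xi_eval H1 a -> xi_eval H2 a.

Definition confluent (G : lmgraph L) : Prop := exists! a, xi_eval G a.

End Recurrence.

(* Main.v *)
(* Either condition makes all the pairs (y_l, z_l) of labels in use multiples
   t_l (y0, z0) of one fixed pair, with z0 = 0 or all w_l = 1. Every evaluation
   of H then yields the state sum
     sum_(S <= E) prod_(e in S) t_e * prod_(e notin S) w_e * prod_C phi(|E(C)|),
   where C runs over the connected components of (V, S), phi(0) = x and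
   phi(m+1) = y0^(m+1) x + y0^m z0. For the edge rule, the terms with e notin S
   give H_-e. When e is in S, its component has m+1 edges and becomes one with
   m edges in H_/e; as phi(m+1) = y0 phi(m) + [m = 0] z0, the terms of H_/e
   remain, plus those of the S in which e is isolated. The latter give the
   extraction of e up to the weights w of the edges meeting e, which are 1
   unless z0 = 0. *)

Require Import Defs.
From HB Require Import structures.
From mathcomp Require Import all_boot all_algebra.

Import GRing.Theory.
Local Open Scope ring_scope.

Set Implicit Arguments.
Unset Strict Implicit.
Unset Printing Implicit Defensive.

(** * Component labellings *)

Section Labelling.
Variables V E : finType.
Implicit Types (d : E -> {set V}) (S : {set E}) (A : {set V}) (u v : V).

(** The edge-closed sets are the unions of components of (V, S). *)
Definition edge_closed d S A : bool :=
  [forall f in S, forall u in d f, forall v in d f, (u \in A) == (v \in A)].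

Lemma edge_closedP d S A :
  reflect (forall f u v, f \in S -> u \in d f -> v \in d f ->
             (u \in A) = (v \in A))
          (edge_closed d S A).
Proof.
apply: (iffP 'forall_implyP) => [cA f u v Sf du dv | cA f Sf].
  by have /'forall_implyP/(_ u du)/'forall_implyP/(_ v dv)/eqP := cA f Sf.
apply/'forall_implyP => u du; apply/'forall_implyP => v dv.
by rewrite (cA f u v).
Qed.

(* The fibres of [f] are the vertex sets of the components of (V, S); the last
   clause avoids paths: a component is not split by any union of components. *)
Definition labelling d S (T : finType) (f : V -> T) : Prop :=
  [/\ forall c, exists u, f u = c,
      forall e u v, e \in S -> u \in d e -> v \in d e -> f u = f v
    & forall A, edge_closed d S A ->
        forall u v, f u = f v -> (u \in A) = (v \in A)].

(** Two vertices lie in the same component exactly when the same closed sets contain them, so this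
    family serves as the name of the component of [u]. *)
Definition closed_nbhds d S u : {set {set V}} :=
  [set A | edge_closed d S A & u \in A].

Definition component d S : finType :=
  {B : {set {set V}} | B \in closed_nbhds d S @: setT}.

Definition component_of d S u : component d S :=
  exist _ (closed_nbhds d S u) (imset_f _ (in_setT u)).

Lemma component_labelling d S : labelling d S (component_of d S).
Proof.
split.
- move=> c; have /imsetP[u _ defc] := valP c.
  by exists u; apply: val_inj; rewrite /= -defc.
- move=> e u v Se du dv; apply: val_inj; apply/setP=> A; rewrite !inE.
  by case: edge_closedP => //= cA; rewrite (cA e u v).
- move=> A cA u v /(congr1 val)/setP/(_ A).
  by rewrite !inE cA.
Qed.

(** The fibre of [g] through [u] is edge-closed, so no fibre of [f] can be split by it. *)
Lemma labelling_eq d S (T T' : finType) (f : V -> T) (g : V -> T') u v :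
  labelling d S f -> labelling d S g -> f u = f v -> g u = g v.
Proof.
move=> [_ _ f_min] [_ g_const _] fuv.
have cA : edge_closed d S [set v | g v == g u].
  apply/edge_closedP=> e u1 u2 Se du1 du2.
  by rewrite !inE (g_const e u1 u2).
by have := f_min _ cA _ _ fuv; rewrite !inE eqxx => /esym/eqP.
Qed.

(** When [f] is a labelling, all ends of an edge of [S] have one label, so this is the number of
    edges of the component [c]. *)
Definition fiber_edges d S (T : finType) (f : V -> T) c : nat :=
  (\sum_(e in S) (c \in f @: d e))%N.

End Labelling.

(** * Products over components *)

Section Product.
Variables (F : fieldType) (phi : nat -> F).

Definition component_prod (V E : finType) (d : E -> {set V}) (S : {set E}) :
    F :=
  \prod_(c : component d S) phi (fiber_edges d S (component_of d S) c).

(** By [labelling_eq] any two labellings have the same fibres; passing through chosen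
    representatives gives a bijection of the labels. Components can thus be computed with whichever
    labelling is convenient. *)
Lemma labelling_prod (V E : finType) (d : E -> {set V}) (S : {set E})
    (T : finType) (f : V -> T) :
  labelling d S f ->
  component_prod d S = \prod_(c : T) phi (fiber_edges d S f c).
Proof.
move=> Lf; have Lg := component_labelling d S.
have [f_surj _ _] := Lf; have [g_surj _ _] := Lg.
set g := component_of d S in Lg g_surj *.
have f_surjb c : exists u, f u == c by have [u <-] := f_surj c; exists u.
have g_surjb c : exists u, g u == c by have [u <-] := g_surj c; exists u.
pose pf c := xchoose (f_surjb c); pose pg c := xchoose (g_surjb c).
have pfK c : f (pf c) = c by apply/eqP/(xchooseP (f_surjb c)).
have pgK c : g (pg c) = c by apply/eqP/(xchooseP (g_surjb c)).
have hK u : g (pf (f u)) = g u by apply: labelling_eq Lf Lg _; rewrite pfK.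
have h'K u : f (pg (g u)) = f u by apply: labelling_eq Lg Lf _; rewrite pgK.
rewrite /component_prod (reindex (fun c => g (pf c))) /=; last first.
  apply: onW_bij; exists (fun c => f (pg c)) => c; first by rewrite h'K pfK.
  by rewrite hK pgK.
apply: eq_bigr => c _; congr phi; apply: eq_bigr => e _; congr nat_of_bool.
apply/imsetP/imsetP => -[u du cu]; exists u => //.
  by rewrite -(pfK c) -(h'K (pf c)) cu h'K.
by rewrite cu hK.
Qed.

(* Covers isomorphism, edge deletion and edge contraction: [X] is the set of
   edges collapsed by the quotient map [p]. *)
Lemma labelling_quotient (V V' E E' T : finType)
    (d : E -> {set V}) (d' : E' -> {set V'}) (p : V -> V') (q : E' -> E)
    (X : {set E}) (S' : {set E'}) (f : V' -> T) :
    (forall v', exists v, p v = v') ->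
    (forall e, d' e = p @: d (q e)) ->
    (forall e u v, e \in X -> u \in d e -> v \in d e -> p u = p v) ->
    (forall u v, p u = p v ->
       u = v \/ exists e, [/\ e \in X, u \in d e & v \in d e]) ->
  labelling d' S' f -> labelling d (X :|: q @: S') (f \o p).
Proof.
move=> p_surj d'E pX p_eq [f_surj f_const f_min]; split=> /=.
- by move=> c; have [u' <-] := f_surj c; have [u <-] := p_surj u'; exists u.
- move=> e u v /setUP[Xe du dv | /imsetP[e' Se' ->] du dv].
    by rewrite (pX e u v).
  by apply: (f_const e') => //; rewrite d'E imset_f.
- move=> A /edge_closedP cA.
  (* A closed set is saturated for [p], since distinct identified vertices are ends of a common edge
     of [X]; hence it descends to a closed set of the quotient. *)
  have Ap u v : p u = p v -> (u \in A) = (v \in A).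
    case/p_eq => [-> // | [e [Xe du dv]]].
    by rewrite (cA e u v) // inE Xe.
  have pA u : (p u \in p @: A) = (u \in A).
    apply/imsetP/idP => [[v Av /Ap -> //] | Au]; by exists u.
  move=> u v fuv; rewrite -!pA; apply: f_min fuv.
  apply/edge_closedP=> e u' v' Se.
  rewrite d'E => /imsetP[u1 du1 ->] /imsetP[v1 dv1 ->]; rewrite !pA.
  by rewrite (cA (q e) u1 v1) // inE imset_f ?orbT.
Qed.

(** The map [q] need not be onto: with [p] the identity this also covers deletion of an unselected
    edge. *)
Lemma component_prod_iso (V V' E E' : finType)
    (d : E -> {set V}) (d' : E' -> {set V'}) (p : V -> V') (q : E' -> E)
    (S' : {set E'}) :
    bijective p -> injective q -> (forall e, d' e = p @: d (q e)) ->
  component_prod d (q @: S') = component_prod d' S'.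
Proof.
move=> [p' pK p'K] q_inj d'E; have Lf := component_labelling d' S'.
have: labelling d (set0 :|: q @: S') (component_of d' S' \o p).
  apply: labelling_quotient Lf => //.
  - by move=> v'; exists (p' v').
  - by move=> e u v; rewrite inE.
  - by move=> u v /(can_inj pK); left.
rewrite set0U => /labelling_prod ->; apply: eq_bigr => c _; congr phi.
rewrite /fiber_edges big_imset; last by move=> ? ? _ _ /q_inj.
by apply: eq_bigr => e _; rewrite d'E imset_comp.
Qed.

Lemma component_prod_union (V1 V2 E1 E2 : finType)
    (d1 : E1 -> {set V1}) (d2 : E2 -> {set V2})
    (d : E1 + E2 -> {set V1 + V2}) (S1 : {set E1}) (S2 : {set E2}) :
    (forall e, d (inl e) = inl @: d1 e) ->
    (forall e, d (inr e) = inr @: d2 e) ->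
  component_prod d (inl @: S1 :|: inr @: S2) =
    component_prod d1 S1 * component_prod d2 S2.
Proof.
move=> dl dr.
have Lf := component_labelling d1 S1; have Lg := component_labelling d2 S2.
rewrite (labelling_prod Lf) (labelling_prod Lg).
(* The sum of the two labellings labels the union: a closed set of the union restricts to closed
   sets on both sides. *)
move: (component_of d1 S1) (component_of d2 S2) Lf Lg => f g Lf Lg.
pose h u := match u with inl u1 => inl (f u1) | inr u2 => inr (g u2) end.
have Lh : labelling d (inl @: S1 :|: inr @: S2) h.
  case: Lf Lg => [f1 f2 f3] [g1 g2 g3]; split.
  - case=> c; first by have [u <-] := f1 c; exists (inl u).
    by have [u <-] := g1 c; exists (inr u).
  - move=> e u v /setUP[] /imsetP[e' Se' ->]; rewrite ?dl ?dr.
      by move=> /imsetP[u' du ->] /imsetP[v' dv ->] /=; rewrite (f2 e' u' v').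
    by move=> /imsetP[u' du ->] /imsetP[v' dv ->] /=; rewrite (g2 e' u' v').
  - move=> A /edge_closedP cA [u|u] [v|v] //= [].
      move=> uv; have := f3 (inl @^-1: A) _ u v uv; rewrite !inE; apply.
      apply/edge_closedP=> e u1 v1 Se du dv; rewrite !inE.
      by apply: (cA (inl e)); rewrite ?dl ?inE ?imset_f.
    move=> uv; have := g3 (inr @^-1: A) _ u v uv; rewrite !inE; apply.
    apply/edge_closedP=> e u1 v1 Se du dv; rewrite !inE.
    by apply: (cA (inr e)); rewrite ?dr ?inE ?imset_f ?orbT.
have disj : [disjoint (inl @: S1 : {set E1 + E2}) & inr @: S2].
  by apply/pred0P => e /=; apply/negbTE/andP => -[/imsetP[? _ ->] /imsetP[]].
rewrite (labelling_prod Lh) big_sumType /=; congr (_ * _);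
    apply: eq_bigr => c _; congr phi; rewrite /fiber_edges.
  rewrite (eq_bigl [predU inl @: S1 & inr @: S2]) => [|e]; last by rewrite !inE.
  rewrite bigU //= !big_imset /=; try by move=> ? ? _ _ [].
  rewrite [X in (_ + X)%N]big1 ?addn0.
    apply: eq_bigr => e _; rewrite dl; congr nat_of_bool.
    apply/imsetP/imsetP => [[u /imsetP[u' du ->] /= [->]]|[u du ->]].
      by exists u'.
    by exists (inl u); rewrite ?imset_f.
  move=> e _; rewrite dr; case: imsetP => // -[u /imsetP[u' du ->] //].
rewrite (eq_bigl [predU inl @: S1 & inr @: S2]) => [|e]; last by rewrite !inE.
rewrite bigU //= !big_imset /=; try by move=> ? ? _ _ [].
rewrite [X in (X + _)%N]big1 ?add0n.
  apply: eq_bigr => e _; rewrite dr; congr nat_of_bool.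
  apply/imsetP/imsetP => [[u /imsetP[u' du ->] /= [->]]|[u du ->]].
    by exists u'.
  by exists (inr u); rewrite ?imset_f.
move=> e _; rewrite dl; case: imsetP => // -[u /imsetP[u' du ->] //].
Qed.

End Product.

(** * The state sum *)

Lemma ends_not_avoid (L : Type) (H : lmgraph L) (e : edge H) :
  ~~ (ends e \subset ~: ends e).
Proof.
have /andP[/card_gt0P[u eu] _] := ends_card e.
by apply/negP=> /subsetP/(_ u eu); rewrite inE eu.
Qed.

Lemma mem_val_imset (T : finType) (a : pred T) u :
  (u \in [set val v | v in [set: {v | a v}]]) = a u.
Proof.
apply/imsetP/idP => [[v _ ->] | au]; first exact: valP v.
by exists (Sub u au).
Qed.

(** * Selections of a smaller graph as selections of a larger one *)

Section Reindexing.
Variables (F : fieldType) (E E' : finType) (q : E' -> E) (X : {set E}).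
Hypotheses (q_inj : injective q) (Xq : forall e, q e \notin X).

Lemma preimsetU_imset (S : {set E'}) : q @^-1: (X :|: q @: S) = S.
Proof. by apply/setP=> e; rewrite !inE (negbTE (Xq e)) mem_imset. Qed.

(** The forced edges [X] are none for isomorphism and deletion, and [[set e]] for contraction and
    extraction; taking preimages under [q] inverts [S |-> X :|: q @: S]. *)
Lemma sum_sets_between (G : {set E} -> F) :
  \sum_(S : {set E} | (X \subset S) && (S \subset X :|: q @: setT)) G S =
  \sum_(S : {set E'}) G (X :|: q @: S).
Proof.
rewrite (reindex_onto (fun S : {set E'} => X :|: q @: S)
                      (fun S : {set E} => q @^-1: S)) /=.
  apply: eq_bigl => S; rewrite preimsetU_imset eqxx subsetUl setUS //.
  exact: imsetS (subsetT S).
move=> S /andP[sXS /subsetP sSX]; apply/setP=> e; rewrite inE.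
apply/orP/idP => [[/(subsetP sXS) // | /imsetP[e' + ->]] | Se].
  by rewrite inE.
have /setUP[-> | /imsetP[e' _ De]] := sSX e Se; [by left | right].
by rewrite De imset_f // inE -De.
Qed.

Lemma prod_extension (a b : E -> F) (S : {set E'}) :
  \prod_e (if e \in X :|: q @: S then a e else b e) =
  (\prod_(e | e \notin q @: setT) (if e \in X then a e else b e)) *
  \prod_e' (if e' \in S then a (q e') else b (q e')).
Proof.
rewrite (bigID (fun e => e \in q @: setT)) /= mulrC; congr (_ * _).
  apply: eq_bigr => e im'e; rewrite inE; case: (e \in X) => //=.
  case: imsetP => // -[e' _ De]; case/negP: im'e.
  by rewrite De imset_f.
rewrite big_imset /=; last by move=> ? ? _ _ /q_inj.
apply: eq_big => [e | e _]; first by rewrite inE.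
by rewrite inE (negbTE (Xq e)) mem_imset.
Qed.

End Reindexing.

(** * The state sum satisfies the rules *)

Section StateSum.
Variables (L : Type) (F : fieldType) (w t : L -> F) (x y0 z0 : F).
Implicit Types H : lmgraph L.

(* The value of a connected graph with [m] edges, all of them selected: every
   edge but the last is contracted, the last is contracted or extracted. *)
Definition component_value (m : nat) : F :=
  if m is n.+1 then y0 ^+ n.+1 * x + y0 ^+ n * z0 else x.

Definition selection_weight H (S : {set edge H}) : F :=
  \prod_e (if e \in S then t (lab e) else w (lab e)).

Definition selection_value H (S : {set edge H}) : F :=
  component_prod component_value (@ends L H) S.

Definition state_sum H : F :=
  \sum_(S : {set edge H}) selection_weight S * selection_value S.

(** The [if] tests whether [e] is isolated, that is, meets no other edge of [S]; then its component
    consists of [ends e] alone and is exactly what extraction removes. *)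
Lemma selection_value_step H (e : edge H) (S : {set edge H}) : e \in S ->
  selection_value S =
    y0 * selection_value (H := contract_edge e) (val @^-1: S) +
    (if S :\ e \subset [set f | ends f \subset ~: ends e]
     then z0 * selection_value (H := extract_edge e) (val @^-1: S) else 0).
Proof.
move=> Se; pose He := contract_edge e; pose p : vert H -> vert He := insub.
pose S' : {set edge He} := val @^-1: S.
have DS : S = [set e] :|: val @: S'.
  apply/setP=> f; rewrite !inE; case: eqP => [-> // | /eqP ne] /=.
  apply/idP/imsetP => [Sf | [f' + ->]]; last by rewrite inE.
  by exists (Sub f ne); rewrite ?inE.
have pN u : (p u == None) = (u \in ends e).
  by rewrite /p; case: insubP => [u' /negbTE-> //|]; rewrite negbK => ->.
have vS'P f (ne : f != e) : (Sub f ne \in S') = (f \in S) by rewrite inE.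
have Lg := component_labelling (@ends L He) S'.
(* Contracting a selected edge neither merges nor splits components, so the same labels serve both
   graphs. *)
have Lf : labelling ends S (component_of (@ends L He) S' \o p).
  rewrite DS; apply: labelling_quotient Lg => //.
  - case=> [u|]; first by exists (val u); rewrite /p valK.
    have /andP[/card_gt0P[u eu] _] := ends_card e.
    by exists u; apply/eqP; rewrite pN.
  - by move=> f u v /set1P->; rewrite -!pN => /eqP-> /eqP->.
  - move=> u v puv; have [eu|e'u] := boolP (u \in ends e).
      by right; exists e; rewrite set11; split; rewrite // -pN -puv pN.
    left; move: puv; rewrite /p insubT.
    by case: insubP => // v' _ <- [<-].
rewrite /selection_value (labelling_prod _ Lf) -/He -/S' (labelling_prod _ Lg).
move: {Lg}(component _ _) (component_of _ _) Lg Lf => T g Lg Lf.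
set f := g \o p in Lf *; pose c0 := g None.
have fe u : u \in ends e -> f u = c0 by rewrite -pN /f /= => /eqP->.
have [u0 eu0] : exists u0, u0 \in ends e.
  by have /andP[/card_gt0P] := ends_card e.
(* Only the component [c0] of [e] loses an edge under contraction. *)
have cntE c : fiber_edges ends S f c = ((c == c0) + fiber_edges ends S' g c)%N.
  rewrite /fiber_edges [in LHS]DS big_setU1 /=; last first.
    by apply/imsetP=> -[[k /= /eqP ne] _ /esym].
  rewrite big_imset /=; last by move=> ? ? _ _ /val_inj.
  congr (nat_of_bool _ + _)%N.
    apply/imsetP/eqP => [[u eu ->]|->]; first exact: fe.
    by exists u0; rewrite ?fe.
  by apply: eq_bigr => k _; rewrite imset_comp.
rewrite [LHS](bigD1 c0) //= [in RHS](bigD1 c0) //= cntE eqxx add1n.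
set m := fiber_edges _ _ _ c0.
rewrite [X in y0 * (_ * X)](eq_bigr (fun c =>
  component_value (fiber_edges ends S f c))); last first.
  by move=> c /negbTE nc; rewrite cntE nc.
set R := \prod_(c | c != c0) _.
(* If another selected edge [k] meets [e], then [m] is positive, where [component_value m.+1 = y0 *
   component_value m]. *)
case: ifPn => [/subsetP iso | /subsetPn[k]]; last first.
  rewrite !inE => /andP[ne Sk] /subsetPn[u ku]; rewrite inE negbK => eu.
  have -> : m = m.-1.+1.
    rewrite prednK // lt0n; apply/eqP => /eqP; rewrite /m sum_nat_eq0.
    move/forall_inP/(_ (Sub k ne)); rewrite vS'P Sk eqb0 => /(_ isT)/imsetP[].
    exists (p u); first exact: imset_f.
    exact/esym/fe.
  by rewrite /= addr0 [in RHS]mulrA mulrDr !mulrA -!exprS.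
have iso' k u : k \in S -> k != e -> u \in ends k -> u \notin ends e.
  move=> Sk ne ku; have := iso k; rewrite !inE Sk ne.
  by move=> /(_ isT)/subsetP/(_ u ku); rewrite inE.
(* With [e] isolated, [ends e] is closed, hence it is the whole fibre of [c0], and [m = 0]. *)
have cle : edge_closed ends S (ends e).
  apply/edge_closedP=> k u v Sk; have [-> -> -> // | ne ku kv] := eqVneq k e.
  by rewrite !(negbTE (iso' k _ Sk ne _)).
have fc0 u : f u = c0 -> u \in ends e.
  case: Lf => _ _ f_min; rewrite -(fe _ eu0) => /(f_min _ cle) ->; exact: eu0.
have -> : m = 0%N.
  apply/eqP; rewrite sum_nat_eq0; apply/forall_inP=> k; rewrite inE => Sk.
  rewrite eqb0; apply/imsetP=> -[_ /imsetP[u ku ->] /esym/fc0].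
  by apply/negP; apply: iso' Sk (valP k) ku.
(* Now [component_value 1 = y0 * x + z0]: the first summand is the contraction term, and [R], the
   product over the other components, must be the value of the extraction. *)
rewrite /= expr0 mul1r expr1 mulrDl mulrA; congr (_ + z0 * _).
pose Hd := extract_edge e; pose S'' : {set edge Hd} := val @^-1: S.
have DS'' : S = e |: val @: S''.
  apply/setP=> k; rewrite !inE; case: eqP => [-> // | /eqP ne] /=.
  apply/idP/imsetP => [Sk | [k' + ->]]; last by rewrite inE.
  have kP : ends k \subset ~: ends e.
    by have := iso k; rewrite !inE ne Sk => /(_ isT).
  by exists (Sub k kP); rewrite ?inE.
have fN (u : vert Hd) : f (val u) \in predC1 c0.
  by rewrite inE; apply: contraTneq (valP u) => /fc0; rewrite inE negbK.
(* The labels other than [c0] label the components of the extraction. *)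
pose h (u : vert Hd) : {c | c \in predC1 c0} := Sub (f (val u)) (fN u).
have hE (u v : vert Hd) : (h u = h v) <-> (f (val u) = f (val v)).
  by split=> [/(congr1 val) | huv]; last apply: val_inj.
have Lh : labelling ends S'' h.
  case: Lf => f_surj f_const f_min; split.
  - move=> c; have [u Du] := f_surj (val c).
    have e'u : u \in ~: ends e.
      rewrite inE; apply: contraL (valP c) => /fe.
      by rewrite Du inE => ->; rewrite eqxx.
    by exists (Sub u e'u); apply: val_inj.
  - move=> k u v; rewrite !inE => Sk ku kv; apply/hE.
    exact: f_const Sk ku kv.
  (* A closed set of the extraction is closed in [H] too, as it contains no end of [e]. *)
  - move=> A /edge_closedP cA u v /hE fuv.
    rewrite -!(mem_imset _ _ val_inj); apply: f_min fuv.
    apply/edge_closedP=> k u1 v1; rewrite {1}DS''.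
    case/setU1P=> [-> | /imsetP[k' Sk' ->]].
      have eA u2 : u2 \in ends e -> (u2 \in val @: A) = false.
        move=> eu2; apply/imsetP=> -[u3 _ Du2]; have := valP u3.
        by rewrite inE -Du2 eu2.
      by move=> /eA-> /eA->.
    move=> ku kv; have /subsetP sk := valP k'.
    have -> : u1 = val (Sub u1 (sk _ ku) : vert Hd) by [].
    have -> : v1 = val (Sub v1 (sk _ kv) : vert Hd) by [].
    by rewrite !(mem_imset _ _ val_inj); apply: cA Sk' _ _; rewrite inE.
rewrite (labelling_prod _ Lh) /R (big_sub (predC1 c0)).
apply: eq_bigr => c _; congr component_value.
have cN : val c == c0 = false by apply/negbTE/(valP c).
rewrite /fiber_edges [in LHS]DS'' big_setU1 /=; last first.
  apply/imsetP=> -[k _ De]; have /subsetP/(_ u0) := valP k.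
  by rewrite /= -De !inE eu0 => /(_ isT).
rewrite big_imset /=; last by move=> ? ? _ _ /val_inj.
rewrite (_ : (val c \in _) = false); last first.
  by apply/imsetP=> -[u /fe-> /eqP]; rewrite cN.
apply: eq_bigr => k _; congr nat_of_bool.
apply/imsetP/imsetP => [[u ku Dc] | [u]].
  have /subsetP sk := valP k.
  by exists (Sub u (sk _ ku)); rewrite ?inE //; apply: val_inj.
by rewrite inE => ku ->; exists (val u).
Qed.

Lemma state_sum_iso H1 H2 : isomorphic H1 H2 -> state_sum H1 = state_sum H2.
Proof.
case=> p [q [p_bij q_bij endsE labE]]; have q_inj := bij_inj q_bij.
have [p' pK p'K] := p_bij.
have q_codom e : e \in q @: setT.
  by have [q' _ q'K] := q_bij; rewrite -(q'K e) imset_f.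
(* As [q] is onto, these bounds hold for every selection. *)
rewrite /state_sum [RHS](eq_bigl (fun S : {set edge H2} =>
  (set0 \subset S) && (S \subset set0 :|: q @: setT))); last first.
  by move=> S; rewrite sub0set set0U; apply/esym/subsetP=> e _.
rewrite sum_sets_between //; last by move=> e; rewrite inE.
apply: eq_bigr => S _; congr (_ * _).
  rewrite /selection_weight prod_extension //; last by move=> e; rewrite inE.
  rewrite [X in X * _]big_pred0 ?mul1r => [|e]; last by rewrite q_codom.
  by apply: eq_bigr => e _; rewrite labE.
rewrite set0U /selection_value.
rewrite (component_prod_iso _ (d' := @ends L H1) (p := p')) //.
  by exists p.
by move=> e; rewrite endsE -imset_comp (eq_imset _ pK) imset_id.
Qed.

Lemma state_sum_union H1 H2 :
  state_sum (disjoint_union H1 H2) = state_sum H1 * state_sum H2.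
Proof.
rewrite /state_sum big_distrlr /= pair_big /=.
pose j (SS : {set edge H1} * {set edge H2}) :
  {set edge H1 + edge H2} := inl @: SS.1 :|: inr @: SS.2.
have jl SS k : (inl k \in j SS) = (k \in SS.1).
  rewrite inE mem_imset; last by move=> ? ? [].
  by case: imsetP => [[] // | _]; rewrite orbF.
have jr SS k : (inr k \in j SS) = (k \in SS.2).
  rewrite inE mem_imset; last by move=> ? ? [].
  by case: imsetP => [[] // | _].
rewrite (reindex j) /=; last first.
  exists (fun S : {set edge H1 + edge H2} => (inl @^-1: S, inr @^-1: S))
    => [[S1 S2] _ | S _].
    by congr (_, _); apply/setP=> k; rewrite inE ?jl ?jr.
  by apply/setP=> -[k|k]; rewrite ?jl ?jr inE.
apply: eq_bigr => SS _; rewrite mulrACA; congr (_ * _).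
  rewrite /selection_weight big_sumType /=.
  by congr (_ * _); apply: eq_bigr => k _; rewrite ?jl ?jr.
exact: component_prod_union.
Qed.

Lemma state_sum_edgeless (T : finType) :
  state_sum (edgeless L T) = x ^+ #|T|.
Proof.
rewrite /state_sum (bigD1 set0) //= big1 => [|S /set0Pn[[]]].
rewrite addr0 /selection_weight big_pred0 ?mul1r => [|[]].
have Lid : labelling (@ends L (edgeless L T)) set0 (id : T -> T).
  split; [by move=> u; exists u | by [] | by move=> A _ u v ->].
rewrite /selection_value (labelling_prod _ Lid) -prodr_const.
by apply: eq_bigr => u _; rewrite /fiber_edges big_set0.
Qed.

Lemma state_sum_step H (e : edge H) :
    (z0 = 0 \/ forall f : edge H, w (lab f) = 1) ->
  state_sum H = w (lab e) * state_sum (del_edge e) +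
                t (lab e) * y0 * state_sum (contract_edge e) +
                t (lab e) * z0 * state_sum (extract_edge e).
Proof.
move=> z0w; rewrite /state_sum (bigID (fun S : {set edge H} => e \in S)) /=.
rewrite addrC -addrA; congr (_ + _).
  rewrite (eq_bigl (fun S : {set edge H} => (set0 \subset S) &&
     (S \subset set0 :|: [set val k | k in [set: edge (del_edge e)]]))) => [|S].
    have e0 (k : edge (del_edge e)) : val k \notin set0 by rewrite inE.
    rewrite sum_sets_between ?mulr_sumr //; last exact: val_inj.
    apply: eq_bigr => S _; rewrite mulrA; congr (_ * _).
      rewrite /selection_weight prod_extension //; last exact: val_inj.
      congr (_ * _); rewrite (big_pred1 e) ?inE // => k.
      by rewrite mem_val_imset negbK.
    rewrite set0U; apply: (component_prod_iso _ (p := id)) => //.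
    - by exists id.
    - exact: val_inj.
    - by move=> k; rewrite imset_id.
  apply/esym; rewrite sub0set set0U; apply/subsetP/idP => [sS | e'S k Sk].
    by apply/negP=> /sS; rewrite mem_val_imset eqxx.
  by rewrite mem_val_imset; apply: contraNneq e'S => <-.
(* The selections containing [e] all contribute to the contraction, and those in which [e] is
   isolated also to the extraction. *)
transitivity (
  \sum_(S : {set edge H} | e \in S) selection_weight S *
     (y0 * selection_value (H := contract_edge e) (val @^-1: S)) +
  \sum_(S : {set edge H} | (e \in S) &&
      (S :\ e \subset [set f | ends f \subset ~: ends e]))
     selection_weight S *
     (z0 * selection_value (H := extract_edge e) (val @^-1: S))).
  rewrite [X in _ + X]big_mkcondr -big_split; apply: eq_bigr => S Se /=.
  rewrite (selection_value_step Se) mulrDr; congr (_ + _).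
  by case: ifP => //; rewrite mulr0.
congr (_ + _).
  rewrite (eq_bigl (fun S : {set edge H} => ([set e] \subset S) && (S \subset
     [set e] :|: [set val k | k in [set: edge (contract_edge e)]]))) => [|S].
    have conNe (k : edge (contract_edge e)) : val k \notin [set e].
      by rewrite inE; apply: valP k.
    rewrite sum_sets_between ?mulr_sumr //; last exact: val_inj.
    apply: eq_bigr => S _; rewrite preimsetU_imset //; last exact: val_inj.
    rewrite !mulrA; congr (_ * _); rewrite mulrAC; congr (_ * _).
    rewrite /selection_weight prod_extension //; last exact: val_inj.
    congr (_ * _); rewrite (big_pred1 e) ?set11 // => k.
    by rewrite mem_val_imset negbK.
  apply/esym; rewrite sub1set andbC; case: subsetP => // -[] k _; rewrite inE.
  by rewrite mem_val_imset in_set1 orbN.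
(* If [z0 = 0] both extraction terms vanish; otherwise all weights [w] are 1. *)
have [-> | z0N] := eqVneq z0 0.
  by rewrite big1 => [|S _]; rewrite ?mulr0 ?mul0r ?mulr0.
have w1 (f : edge H) : w (lab f) = 1.
  by case: z0w => [/eqP|->//]; rewrite (negbTE z0N).
have extNe (k : edge (extract_edge e)) : val k \notin [set e].
  rewrite inE; apply: contraNneq (ends_not_avoid e) => De.
  by rewrite -{1}De (valP k).
rewrite (eq_bigl (fun S : {set edge H} => ([set e] \subset S) && (S \subset
   [set e] :|: [set val k | k in [set: edge (extract_edge e)]]))) => [|S].
  rewrite sum_sets_between ?mulr_sumr //; last exact: val_inj.
  apply: eq_bigr => S _; rewrite preimsetU_imset //; last exact: val_inj.
  rewrite !mulrA; congr (_ * _); rewrite mulrAC; congr (_ * _).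
  rewrite /selection_weight prod_extension //; last exact: val_inj.
  congr (_ * _).
  (* The edges lost by extraction are [e], contributing [t (lab e)], and the unselected edges
     meeting it, each contributing 1. *)
  rewrite (bigD1 e) ?mem_val_imset ?ends_not_avoid //= set11 big1 ?mulr1 //.
  move=> k.
  by rewrite in_set1 => /andP[_ /negbTE->].
apply/esym; rewrite sub1set; case: (e \in S) => //=.
rewrite subDset; congr (S \subset _); congr (_ :|: _).
apply/setP=> k; rewrite inE mem_val_imset //.
Qed.

(** Being a condition on single labels, it passes to every graph produced by the rules. *)
Definition compatible (y z : L -> F) (l : L) : Prop :=
  [/\ y l = t l * y0, z l = t l * z0 & z0 = 0 \/ w l = 1].

Lemma xi_eval_state_sum (y z : L -> F) H a :
  xi_eval w y z x H a -> (forall e : edge H, compatible y z (lab e)) ->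
  a = state_sum H.
Proof.
elim=> {H a}.
- move=> H e a b c _ IHa _ IHb _ IHc Hc.
  rewrite (state_sum_step e); last first.
    have [_ _ [|_]] := Hc e; first by left.
    have [|z0N] := eqVneq z0 0; [by left | right=> f].
    by have [_ _ []] := Hc f => // /eqP; rewrite (negbTE z0N).
  have [-> -> _] := Hc e.
  by rewrite IHa ?IHb ?IHc // => f; apply: Hc.
- move=> H1 H2 a b _ IHa _ IHb Hc; rewrite state_sum_union.
  by rewrite IHa ?IHb // => f; [apply: (Hc (inr f)) | apply: (Hc (inl f))].
- by rewrite state_sum_edgeless card_unit.
- by rewrite state_sum_edgeless card_void.
- move=> H1 H2 a iso12 _ IHa Hc; rewrite -(state_sum_iso iso12); apply: IHa.
  by have [p [q [_ _ _ labE]]] := iso12; move=> e; rewrite -labE.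
Qed.

End StateSum.

(** * Every graph can be evaluated *)

Section Existence.
Variables (L : Type) (F : fieldType) (w y z : L -> F) (x : F).

Lemma xi_eval_edgeless n : exists a, xi_eval w y z x (edgeless L 'I_n) a.
Proof.
have iso (T T' : finType) (p : T -> T') : bijective p ->
    isomorphic (edgeless L T) (edgeless L T').
  by move=> p_bij; exists p, id; split=> //; exists id.
elim: n => [|n [a IHn]].
  exists 1; apply: xi_iso (xi_empty w y z x).
  apply: (iso void _ (fun v => match v with end)).
  by exists (fun i : 'I_0 => match notF (ltn_ord i) with end) => [[]|[]].
exists (x * a); apply: xi_iso (xi_union (xi_E1 w y z x) IHn).
pose p (u : unit + 'I_n) : 'I_n.+1 :=
  match u with inl _ => ord0 | inr i => lift ord0 i end.
exists p, (fun k => match k with inl k => k | inr k => k end).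
split=> [||[[]|[]]|[[]|[]]]; last by exists inl => [[]|[]].
exists (fun i => if unlift ord0 i is Some j then inr j else inl tt).
  by case=> [[]|i]; rewrite /p ?unlift_none ?liftK.
by move=> i; case: unliftP => [j|] ->.
Qed.

(** Induction on the number of edges: each of the three operations loses at least [e]. *)
Lemma xi_eval_exists (H : lmgraph L) : exists a, xi_eval w y z x H a.
Proof.
have [n] := ubnP #|edge H|; elim: n H => // n IHn H ltHn.
have [E0 | /card_gt0P[e _]] := posnP #|edge H|.
  have [a eva] := xi_eval_edgeless #|vert H|; exists a; apply: xi_iso eva.
  have noE (k : edge H) : False.
    by have := fintype0 k; apply.
  exists enum_val, (fun k : void => match k with end).
  split=> [||[]|[]]; first exact: enum_val_bij.
  by exists (fun k => match noE k with end) => [[]|k]; case: (noE k).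
have lt_sub (a : pred (edge H)) : ~~ a e -> (#|{: {k | a k}}| < n)%N.
  move=> a'e; rewrite card_sig; apply: leq_trans (ltHn : _ <= n)%N.
  by apply/proper_card/properP; split; [apply/subsetP | exists e].
have [a eva] : exists a, xi_eval w y z x (del_edge e) a.
  by apply: IHn; apply: lt_sub; rewrite negbK.
have [b evb] : exists a, xi_eval w y z x (contract_edge e) a.
  by apply: IHn; apply: lt_sub; rewrite negbK.
have [c evc] : exists a, xi_eval w y z x (extract_edge e) a.
  exact/IHn/lt_sub/ends_not_avoid.
exact: ex_intro (xi_edge eva evb evc).
Qed.

Lemma compatible_confluent (t : L -> F) (y0 z0 : F) (G : lmgraph L) :
  (forall e : edge G, compatible w t y0 z0 y z (lab e)) ->
  confluent w y z x G.
Proof.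
move=> Gc; have [a eva] := xi_eval_exists G; exists a; split=> // b evb.
by rewrite (xi_eval_state_sum eva Gc) (xi_eval_state_sum evb Gc).
Qed.

End Existence.

Theorem theorem3 (L : Type) (F : fieldType) (w y z : L -> F) (x : F)
    (G : lmgraph L) :
  ((forall e : edge G, z (lab e) = 0) -> confluent w y z x G) /\
  ((forall e : edge G, w (lab e) = 1) /\
   (forall e1 e2 : edge G,
      y (lab e1) * z (lab e2) = y (lab e2) * z (lab e1)) ->
   confluent w y z x G).
Proof.
split=> [z0 | [w1 yz]].
  (* All pairs are multiples [y l] of (1, 0). *)
  apply: (@compatible_confluent _ _ _ _ _ _ y 1 0) => e.
  by split; rewrite ?mulr1 ?mulr0 //; left.
(* A pair with nonzero [y] serves as the common direction, the other pairs being proportional to it;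
   if every [y] vanishes, (0, 1) does. *)
have [e0 y_e0 | y0] := pickP (fun e : edge G => y (lab e) != 0).
  pose t l := y l / y (lab e0).
  apply: (@compatible_confluent _ _ _ _ _ _ t (y (lab e0)) (z (lab e0))) => e.
  split; [by rewrite divfK | | by right].
  by rewrite /t mulrAC yz mulrAC divff // mul1r.
have{}y0 (e : edge G) : y (lab e) = 0 by have /negbFE/eqP := y0 e.
apply: (@compatible_confluent _ _ _ _ _ _ z 0 1) => e.
by split; rewrite ?mulr0 ?mulr1 //; right.
Qed.
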